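(* Let $\sigma>0$, let $f:\mathbb{R}^n\to\mathbb{R}$ be locally Lipschitz continuous, and let $g(x):=f(x)+\frac{\sigma}{2}\|x\|^2$. Assume: (A1) $f$ is path-differentiable and admits a convex-valued set-valued mapping $\mathcal{D}_f$ as its conservative field; (A2) the set $\{g(x):x\in\mathbb{R}^n,\ 0\in\mathcal{D}_f(x)+\sigma x\}$ has empty interior in $\mathbb{R}$; (A3) $\inf_{x\in\mathbb{R}^n}g(x)>-\infty$. Let $\{x_k\},\{m_k\},\{v_k\},\{g_k\},\{d_k\},\{\xi_k\}$ be sequences generated by the framework (AFMDW) described in the context, and assume: (B1) there exist constants $0<\varepsilon_v<M_v$ such that $\varepsilon_v\le H(v_k)\le M_v$ (entrywise) for all $k\ge 0$; (B2) there exists a constant $M_x$ such that almost surely $\max\{\|m_0\|,\sup_{k\ge0}\|x_k\|\}\le M_x$; (B3) the stepsizes $\{\eta_k\}$, $\{\theta_k\}$ are positive and satisfy $\inf_{k\ge0}\eta_k>0$, $\sup_{k\ge0}\eta_k<\frac{2}{\sigma M_v}$, $\sum_{k=0}^\infty\theta_k=\infty$, $\lim_{k\to\infty}\theta_k\log(k)=0$; (B4) there exists a nonnegative sequence $\{\delta_k\}$ with $\lim_{k\to\infty}\delta_k=0$ and $d_k\in\mathcal{D}_f^{\delta_k}(x_k)$ for all $k$; (B5) $\{\xi_k\}$ is a uniformly bounded martingale difference sequence: there is a constant $M_\xi$ such that almost surely $\sup_{k\ge0}\|\xi_k\|\le M_\xi$, and $\mathbb{E}[\xi_{k+1}\mid\mathcal{F}_k]=0$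 for all $k\ge0$. Then there exists a nonnegative sequence $\{\hat\delta_k\}$ such that $\lim_{k\to\infty}\hat\delta_k=0$ and, almost surely, $\|\sigma x_k+m_k\|\le\hat\delta_k$ holds for all $k\ge0$.
   Context: All random variables live on a probability space $(\Omega,\mathcal{F},\mathbb{P})$ with a filtration $\{\mathcal{F}_k\}$ to which $\{\xi_k\}$ is adapted. $\odot$ is the entrywise product. Framework (AFMDW): from an initial point $(x_0,m_0,v_0)$, for $k\ge0$: $g_k=d_k+\xi_{k+1}$; $m_{k+1}=(1-\theta_k)m_k+\theta_k g_k$; choose an estimator $v_{k+1}\in\mathbb{R}^n$ (by any rule); $x_{k+1}=x_k-\eta_k H(v_{k+1})\odot(m_{k+1}+\sigma x_k)$. Here $H:\mathbb{R}^n\to\mathbb{R}^n$ is a given mapping. A conservative field on $\mathbb{R}^n$ is a graph-closed set-valued mapping $\mathcal{D}:\mathbb{R}^n\rightrightarrows\mathbb{R}^n$ with nonempty compact values such that $\int_0^1\max_{v\in\mathcal{D}(\gamma(t))}\langle\gamma'(t),v\rangle\,dt=0$ for every absolutely continuous $\gamma:[0,1]\to\mathbb{R}^n$ with $\gamma(0)=\gamma(1)$; every conservative field is locally bounded. A function $f$ admits $\mathcal{D}$ as its conservative field if $f(\gamma(1))=f(\gamma(0))+\int_0^1\max_{d\in\mathcal{D}(\gamma(t))}\langle\gamma'(t),d\rangle\,dt$ for every absolutely continuous $\gamma:[0,1]\to\mathbb{R}^n$. A locally Lipschitz function is path-differentiable if it admits some conservative field. For a set-valued mapping $\mathcal{D}$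 and $\delta\ge0$, $\mathcal{D}^\delta(x):=\{w\in\mathbb{R}^n:\exists z\in\mathbb{B}_\delta(x),\ \mathrm{dist}(w,\mathcal{D}(z))\le\delta\}$, where $\mathbb{B}_\delta(x)$ is the ball of radius $\delta$ centred at $x$. *)

(* Defs.v *)
From HB Require Import structures.
From mathcomp Require Import all_boot all_order all_algebra.
From mathcomp Require Import all_classical all_reals all_analysis.
Set Implicit Arguments.
Unset Strict Implicit.
Unset Printing Implicit Defensive.
Import Order.TTheory GRing.Theory Num.Theory.
Import numFieldNormedType.Exports.
Local Open Scope classical_set_scope.
Local Open Scope ring_scope.

(* The library norm [`|x|] on ['rV[R]_n] is the sup norm; topological notions
   (closed, compact, interior, derivative) do not depend on that choice, but
   norms, balls and distances below are Euclidean. *)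
Definition dot {R : realType} {n : nat} (u v : 'rV[R]_n) : R :=
  \sum_(i < n) u 0 i * v 0 i.

Definition enorm {R : realType} {n : nat} (u : 'rV[R]_n) : R :=
  Num.sqrt (dot u u).

Definition hadamard {R : realType} {n : nat} (u v : 'rV[R]_n) : 'rV[R]_n :=
  map2_mx *%R u v.

(* Value +oo when [A] is empty. *)
Definition edistance {R : realType} {n : nat} (w : 'rV[R]_n) (A : set 'rV[R]_n)
    : \bar R :=
  ereal_inf [set (enorm (w - a))%:E | a in A].

Definition abs_continuous {R : realType} {n : nat} (a b : R) (c : R -> 'rV[R]_n)
    : Prop :=
  forall e : R, 0 < e -> exists2 r : R, 0 < r &
    forall (N : nat) (s t : 'I_N -> R),
      (forall i, a <= s i /\ s i <= t i /\ t i <= b) ->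
      trivIset [set: 'I_N] (fun i => `]s i, t i[%classic) ->
      \sum_(i < N) (t i - s i) < r ->
      \sum_(i < N) enorm (c (t i) - c (s i)) < e.

(* The integral over [0,1] of max_{v in D(c(t))} <c'(t), v>; the [sup] is a
   maximum whenever [D] has nonempty compact values. The curve is a function on
   all of R, and its derivative is only meaningful for almost every t in [0,1]. *)
Definition path_integral {R : realType} {n : nat} (D : 'rV[R]_n -> set 'rV[R]_n)
    (c : R -> 'rV[R]_n) : \bar R :=
  (\int[lebesgue_measure]_(t in `[0%R, 1%R])
    (sup [set dot (derive1 c t) v | v in D (c t)])%:E)%E.

Definition locally_bounded {R : realType} {n : nat}
    (D : 'rV[R]_n -> set 'rV[R]_n) : Prop :=
  forall x : 'rV[R]_n, exists M : R, \forall y \near x, forall v, D y v -> enorm v <= M.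

(* Local boundedness, a standing property of conservative fields, is part of the
   definition because it does not follow from the other clauses: on R, the field
   D(1/j) = {j} for j >= 1 and D(x) = {0} elsewhere satisfies all of them. *)
Definition conservative_field {R : realType} {n : nat}
    (D : 'rV[R]_n -> set 'rV[R]_n) : Prop :=
  [/\ closed [set p : 'rV[R]_n * 'rV[R]_n | D p.1 p.2],
      (forall x, D x !=set0 /\ compact (D x)),
      locally_bounded D &
      forall c : R -> 'rV[R]_n, abs_continuous 0 1 c -> c 0 = c 1 ->
        path_integral D c = 0%E].

Definition admits {R : realType} {n : nat} (f : 'rV[R]_n -> R)
    (D : 'rV[R]_n -> set 'rV[R]_n) : Prop :=
  conservative_field D /\
  forall c : R -> 'rV[R]_n, abs_continuous 0 1 c ->
    ((f (c 1))%:E = (f (c 0))%:E + path_integral D c)%E.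

Definition locally_lipschitz {R : realType} {n : nat} (f : 'rV[R]_n -> R)
    : Prop :=
  forall x : 'rV[R]_n, exists2 U, nbhs x U & [lipschitz f y | y in U].

Definition path_differentiable {R : realType} {n : nat} (f : 'rV[R]_n -> R)
    : Prop :=
  locally_lipschitz f /\ exists D, admits f D.

Definition convex_valued {R : realType} {n : nat}
    (D : 'rV[R]_n -> set 'rV[R]_n) : Prop :=
  forall x, convex_set (D x : set (convex_lmodType 'rV[R]_n)).

(* The enlargement D^delta, with closed balls, so that D^0 is meaningful. *)
Definition enlargement {R : realType} {n : nat} (D : 'rV[R]_n -> set 'rV[R]_n)
    (delta : R) (x : 'rV[R]_n) : set 'rV[R]_n :=
  [set w | exists2 z, enorm (z - x) <= delta & (edistance w (D z) <= delta%:E)%E].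

Definition regularized {R : realType} {n : nat} (sigma : R) (f : 'rV[R]_n -> R)
    (x : 'rV[R]_n) : R :=
  f x + sigma / 2 * enorm x ^+ 2.

(* Measurability of a random vector with respect to a sub-sigma-algebra [G],
   the target carrying its Borel sigma-algebra. *)
Definition measurable_wrt {T : Type} {R : realType} {n : nat}
    (G : set (set T)) (X : T -> 'rV[R]_n) : Prop :=
  forall B, <<s [set U : set 'rV[R]_n | open U] >> B -> G (X @^-1` B).

Definition filtration {disp : measure_display} {T : measurableType disp}
    (F : nat -> set (set T)) : Prop :=
  [/\ (forall k, sigma_algebra setT (F k)),
      (forall k, F k `<=` measurable) &
      forall k, F k `<=` F k.+1].

(* [Y] is a version of the conditional expectation of [X] given [G]. *)
Definition cond_expectation {disp : measure_display}
    {T : measurableType disp} {R : realType} (P : probability T R)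
    (G : set (set T)) (X Y : T -> R) : Prop :=
  [/\ P.-integrable setT (EFin \o X),
      P.-integrable setT (EFin \o Y),
      (forall B : set R, measurable B -> G (Y @^-1` B)) &
      forall A, G A ->
        (\int[P]_(w in A) (X w)%:E = \int[P]_(w in A) (Y w)%:E)%E].

Definition afmdw {R : realType} {n : nat} (sigma : R)
    (H : 'rV[R]_n -> 'rV[R]_n) (eta theta : nat -> R)
    (x m v g d xi : nat -> 'rV[R]_n) : Prop :=
  forall k : nat,
    [/\ g k = d k + xi k.+1,
        m k.+1 = (1 - theta k) *: m k + theta k *: g k &
        x k.+1 = x k - eta k *: hadamard (H (v k.+1)) (m k.+1 + sigma *: x k)].

(* Main.v *)
Require Import Defs.
From HB Require Import structures.
From mathcomp Require Import all_boot all_order all_algebra.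
From mathcomp Require Import all_classical all_reals all_analysis.
From mathcomp Require Import ring.
Set Implicit Arguments.
Unset Strict Implicit.
Unset Printing Implicit Defensive.
Import Order.TTheory GRing.Theory Num.Theory.
Import numFieldNormedType.Exports.
Local Open Scope classical_set_scope.
Local Open Scope ring_scope.

(** The noise never has to average out. Put s_k = sigma x_k + m_k. Eliminating
    x_{k+1} and m_{k+1} gives, in each coordinate,
      s_{k+1} = (1 - sigma eta_k h_k) (s_k + theta_k (g_k - m_k)),
    where h_k lies in [eps_v, M_v]. As eta_k stays in a compact subinterval
    of ]0, 2 / (sigma M_v)[, the first factor is at most some rho < 1 in absolute
    value, uniformly in k. The perturbation is small because theta_k tends to 0
    and g_k is bounded: the x_k stay in a fixed ball, on a neighbourhood of which
    the locally bounded field Df is bounded by compactness, and the noise is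
    bounded. Since m_k = s_k - sigma x_k, the momentum needs no separate bound:
      |s_{k+1}| <= rho (1 + theta_k) |s_k| + rho C theta_k.
    All the constants here are deterministic, so solving this recursion with
    equality ([affine_recursion]) yields one sequence that dominates every
    coordinate along almost every trajectory, and it tends to 0 because
    rho (1 + theta_k) tends to rho < 1 ([affine_recursion_cvg0]). *)

(** * Coordinates and the Euclidean norm *)

Lemma coord_le_enorm (R : realType) (n : nat) (u : 'rV[R]_n) (i : 'I_n) :
  `|u 0 i| <= enorm u.
Proof.
rewrite -sqrtr_sqr /enorm ler_wsqrtr // /dot (bigD1 i) //= expr2 lerDl.
by apply: sumr_ge0 => j _; rewrite -expr2 sqr_ge0.
Qed.

Lemma enorm_le_coord (R : realType) (n : nat) (u : 'rV[R]_n) (b : R) :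
  0 <= b -> (forall i, `|u 0 i| <= b) -> enorm u <= Num.sqrt n%:R * b.
Proof.
move=> b_ge0 ub; rewrite -[b in X in _ <= X]ger0_norm // -sqrtr_sqr.
rewrite -sqrtrM // /enorm ler_wsqrtr // /dot.
apply: (@le_trans _ _ (\sum_(i < n) b ^+ 2)).
  apply: ler_sum => i _; rewrite -expr2 -real_normK ?num_real //.
  by rewrite lerXn2r ?nnegrE.
by rewrite sumr_const card_ord mulr_natl.
Qed.

(** * Boundedness of enlargements of locally bounded fields *)

(** Compactness of the cube turns local bounds into a uniform one. *)
Lemma locally_bounded_cube (R : realType) (n : nat)
    (D : 'rV[R]_n -> set 'rV[R]_n) (r : R) :
  locally_bounded D ->
  exists M : R, forall z : 'rV[R]_n, (forall i, `|z 0 i| <= r) ->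
    forall v, D z v -> enorm v <= M.
Proof.
move=> Dbnd.
have K_compact : compact [set z : 'rV[R]_n | forall i, `[- r, r]%classic (z ord0 i)].
  by apply: (rV_compact (fun=> @segment_compact R (- r) r)).
move/compact_near_coveringP: K_compact.
pose bounds (M : R) (z : 'rV[R]_n) := forall v, D z v -> enorm v <= M.
move=> /(_ R (pinfty_nbhs R) bounds _) [z _|M [_ boundM]].
  have [M DM] := Dbnd z.
  exists ([set y | forall v, D y v -> enorm v <= M], [set M' | M <= M']).
    by split => //=; apply: nbhs_pinfty_ge; exact: num_real.
  by move=> [y M'] /= [DyM MM'] v /DyM /le_trans; apply.
exists (M + 1) => z zr v Dzv; apply: (boundM (M + 1) _ z _ v Dzv); first by rewrite ltrDl.
by move=> i; rewrite /= in_itv /= -ler_norml.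
Qed.

Lemma enlargement_bounded (R : realType) (n : nat)
    (D : 'rV[R]_n -> set 'rV[R]_n) (r c : R) :
  locally_bounded D ->
  exists M : R, forall (x w : 'rV[R]_n) (delta : R) (i : 'I_n),
    enorm x <= r -> delta <= c -> enlargement D delta x w -> `|w 0 i| <= M.
Proof.
move=> /(@locally_bounded_cube _ _ _ (r + c)) [M DM].
exists (c + 1 + M) => x w delta i xr dc [z zx wD].
(* The infimum defining the distance need not be attained: the extra 1 is slack. *)
have [_ [a Da <-]] : exists2 y, [set (enorm (w - a))%:E | a in D z] y &
    (y < (delta + 1)%:E)%E.
  by apply: ereal_inf_lt; rewrite (le_lt_trans wD) // lte_fin ltrDl.
rewrite lte_fin => wa.
have aM : `|a 0 i| <= M.
  apply: le_trans (coord_le_enorm a i) _; apply: (DM z) => // j.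
  rewrite -[z 0 j](subrK (x 0 j)) addrC; apply: le_trans (ler_normD _ _) _.
  apply: lerD; first exact: le_trans (coord_le_enorm _ _) xr.
  have := coord_le_enorm (z - x) j; rewrite !mxE => /le_trans; apply.
  exact: le_trans zx dc.
rewrite -[w 0 i](subrK (a 0 i)); apply: le_trans (ler_normD _ _) _.
apply: lerD aM; have := coord_le_enorm (w - a) i; rewrite !mxE => /le_trans; apply.
by apply: le_trans (ltW wa) _; rewrite lerD2r.
Qed.

(** * Stepsizes *)

(** For k >= e the logarithm is at least 1. *)
Lemma cvg0_of_mul_ln (R : realType) (u : nat -> R) :
  (forall k, 0 <= u k) -> (fun k => u k * ln k%:R) @ \oo --> (0 : R) ->
  u @ \oo --> (0 : R).
Proof.
move=> u_ge0 ulog.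
apply: (@squeeze_cvgr _ _ _ _ (fun=> 0) (fun k => u k * ln k%:R)) ulog.
  near=> k; rewrite u_ge0 /= ler_peMr //.
  have ek : expR 1 <= k%:R :> R by near: k; exact: nbhs_infty_ger.
  rewrite -[X in X <= _]expRK ler_ln ?posrE ?expR_gt0 //.
  exact: lt_le_trans (expR_gt0 1) ek.
exact: cvg_cst.
Unshelve. all: by end_near. Qed.

(** The product sigma eta_k h ranges in a compact subinterval of ]0, 2[. *)
Lemma uniform_contraction (R : realType) (sigma eps_v M_v : R) (eta : nat -> R) :
  0 < sigma -> 0 < eps_v -> eps_v < M_v ->
  (0%:E < ereal_inf (range (fun k => (eta k)%:E)))%E ->
  (ereal_sup (range (fun k => (eta k)%:E)) < (2 / (sigma * M_v))%:E)%E ->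
  exists rho : R, [/\ 0 <= rho, rho < 1 & forall k h,
    eps_v <= h -> h <= M_v -> `|1 - sigma * eta k * h| <= rho].
Proof.
move=> s0 e0 eM inf_gt sup_lt; have M0 : 0 < M_v by exact: lt_trans eM.
have [a a0 aeta] : exists2 a, 0 < a & forall k, a <= eta k.
  move: inf_gt.
  have: forall k, (ereal_inf (range (fun k => (eta k)%:E)) <= (eta k)%:E)%E.
    by move=> k; apply: ereal_inf_lbound; exists k.
  case: ereal_inf => [a| |] // lb a0; first by exists a => // k; exact: lb.
  by have := lb 0%N.
have [b bM etab] : exists2 b, b < 2 / (sigma * M_v) & forall k, eta k <= b.
  move: sup_lt.
  have: forall k, ((eta k)%:E <= ereal_sup (range (fun k => (eta k)%:E)))%E.
    by move=> k; apply: ereal_sup_ubound; exists k.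
  case: ereal_sup => [b| |] // ub bM; first by exists b => // k; exact: ub.
  by have := ub 0%N.
have bound k h : eps_v <= h -> h <= M_v ->
    `|1 - sigma * eta k * h| <=
      Num.max (1 - sigma * a * eps_v) (sigma * b * M_v - 1).
  move=> eh hM; have ak := aeta k; have kb := etab k.
  have lo : sigma * a * eps_v <= sigma * eta k * h.
    rewrite -!mulrA ler_wpM2l ?(ltW s0) // ler_pM //; exact: ltW.
  have hi : sigma * eta k * h <= sigma * b * M_v.
    rewrite -!mulrA ler_wpM2l ?(ltW s0) // ler_pM //.
      by rewrite (le_trans (ltW a0)).
    by rewrite (le_trans (ltW e0)).
  rewrite le_max; case: ger0P => _; apply/orP.
    by left; rewrite lerD2l lerN2.
  by right; rewrite opprB lerD2r.
exists (Num.max (1 - sigma * a * eps_v) (sigma * b * M_v - 1)); split=> //.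
  exact: le_trans (normr_ge0 _) (bound 0%N eps_v (lexx _) (ltW eM)).
rewrite gt_max ltrBlDr ltrDl !mulr_gt0 //= ltrBlDr.
by move: bM; rewrite ltr_pdivlMr ?mulr_gt0 // mulrCA mulrA -[1 + 1]/2.
Qed.

(** * Affine recursions with asymptotically contracting coefficients *)

Fixpoint affine_recursion (R : realType) (a c : nat -> R) (u0 : R) (k : nat) : R :=
  if k is k'.+1 then a k' * affine_recursion a c u0 k' + c k' else u0.

Lemma affine_recursion_ge0 (R : realType) (a c : nat -> R) (u0 : R) (k : nat) :
  (forall j, 0 <= a j) -> (forall j, 0 <= c j) -> 0 <= u0 ->
  0 <= affine_recursion a c u0 k.
Proof.
by move=> a0 c0 u0_ge0; elim: k => //= k IH; rewrite addr_ge0 ?mulr_ge0.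
Qed.

(** Fix q with rho < q < 1. Once a_k <= q and c_k <= (1 - q) e / 2, the excess
    of the solution over e / 2 is multiplied by at most q at each step. *)
Lemma affine_recursion_cvg0 (R : realType) (a c : nat -> R) (u0 rho : R) :
  (forall j, 0 <= a j) -> (forall j, 0 <= c j) -> 0 <= u0 -> 0 <= rho -> rho < 1 ->
  a @ \oo --> rho -> c @ \oo --> (0 : R) ->
  affine_recursion a c u0 @ \oo --> (0 : R).
Proof.
move=> a0 c0 u0_ge0 rho_ge0 rho_lt1 a_rho c_0; set u := affine_recursion a c u0.
have u_ge0 k : 0 <= u k by exact: affine_recursion_ge0.
pose q := (rho + 1) / 2.
have rho_q : rho < q by rewrite midf_lt.
have q_lt1 : q < 1 by rewrite midf_lt.
have q_ge0 : 0 <= q by rewrite (le_trans rho_ge0) // ltW.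
apply/cvgr0Pnorm_le => e e0.
have [N _ tail] : \forall k \near \oo, a k < q /\ c k < (1 - q) * (e / 2).
  near=> k; split; near: k; first exact: cvgr_lt a_rho _ rho_q.
  by apply: cvgr_lt c_0 _ _; rewrite mulr_gt0 ?divr_gt0 // subr_gt0.
have excess j : u (j + N)%N <= e / 2 + u N * q ^+ j.
  elim: j => [|j IH]; first by rewrite add0n expr0 mulr1 lerDr ltW ?divr_gt0.
  have [/ltW aq /ltW cq] := tail (j + N)%N (leq_addl _ _).
  rewrite addSn /u /= -/u.
  apply: le_trans (lerD (le_trans (ler_wpM2r (u_ge0 _) aq) (ler_wpM2l q_ge0 IH)) cq) _.
  by rewrite exprS le_eqVlt; apply/orP; left; apply/eqP; field.
have uNq : geometric (u N) q @ \oo --> (0 : R).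
  by apply: cvg_geometric; rewrite ger0_norm.
have [J _ small] : \forall j \near \oo, geometric (u N) q j < e / 2.
  by apply: cvgr_lt uNq _ _; rewrite divr_gt0.
exists (J + N)%N => // k /= JNk; rewrite ger0_norm //.
have Nk : (N <= k)%N by exact: leq_trans (leq_addl _ _) JNk.
rewrite -(subnK Nk); apply: le_trans (excess _) _.
rewrite [leRHS]splitr lerD2l ltW //; apply: small => /=.
by rewrite leq_subRL // addnC.
Unshelve. all: by end_near. Qed.

(** * Decay of sigma x_k + m_k *)

Theorem lemma3p5 (R : realType) (n : nat)
  (disp : measure_display) (T : measurableType disp) (P : probability T R)
  (F : nat -> set (set T)) (F_filtration : filtration F)
  (sigma : R) (sigma_gt0 : 0 < sigma)
  (f : 'rV[R]_n -> R) (f_lip : locally_lipschitz f)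
  (Df : 'rV[R]_n -> set 'rV[R]_n)
  (A1 : [/\ path_differentiable f, admits f Df & convex_valued Df])
  (A2 : interior [set regularized sigma f x | x in
          [set x | exists2 s, Df x s & s + sigma *: x = 0]] = set0)
  (A3 : (-oo < ereal_inf (range (fun x => (regularized sigma f x)%:E)))%E)
  (H : 'rV[R]_n -> 'rV[R]_n) (eta theta : nat -> R)
  (x m v g d xi : nat -> T -> 'rV[R]_n)
  (x_rv : forall k, measurable_wrt measurable (x k))
  (m_rv : forall k, measurable_wrt measurable (m k))
  (v_rv : forall k, measurable_wrt measurable (v k))
  (g_rv : forall k, measurable_wrt measurable (g k))
  (d_rv : forall k, measurable_wrt measurable (d k))
  (xi_adapted : forall k, measurable_wrt (F k) (xi k))
  (xmv_afmdw : forall w : T,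
     afmdw sigma H eta theta (x ^~ w) (m ^~ w) (v ^~ w) (g ^~ w) (d ^~ w)
       (xi ^~ w))
  (eps_v M_v : R) (eps_v_gt0 : 0 < eps_v) (eps_v_lt : eps_v < M_v)
  (B1 : {ae P, forall w, forall (k : nat) (i : 'I_n),
          eps_v <= H (v k w) 0 i /\ H (v k w) 0 i <= M_v})
  (B2 : exists M_x : R, {ae P, forall w,
          enorm (m 0%N w) <= M_x /\ forall k, enorm (x k w) <= M_x})
  (B3_pos : forall k, 0 < eta k /\ 0 < theta k)
  (B3_inf : (0%:E < ereal_inf (range (fun k => (eta k)%:E)))%E)
  (B3_sup : (ereal_sup (range (fun k => (eta k)%:E))
              < (2 / (sigma * M_v))%:E)%E)
  (B3_sum : (\sum_(0 <= k <oo) (theta k)%:E = +oo)%E)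
  (B3_lim : (fun k : nat => theta k * ln k%:R) @ \oo --> (0 : R))
  (B4 : exists delta : nat -> R,
     [/\ (forall k, 0 <= delta k), delta @ \oo --> (0 : R) &
         {ae P, forall w, forall k, enlargement Df (delta k) (x k w) (d k w)}])
  (B5_bounded : exists M_xi : R,
     {ae P, forall w, forall k, enorm (xi k w) <= M_xi})
  (B5_martingale : forall (k : nat) (i : 'I_n),
     cond_expectation P (F k) (fun w => xi k.+1 w 0 i) (fun=> 0)) :
  exists delta_hat : nat -> R,
    [/\ (forall k, 0 <= delta_hat k), delta_hat @ \oo --> (0 : R) &
        {ae P, forall w, forall k,
           enorm (sigma *: x k w + m k w) <= delta_hat k}].
Proof.
have [_ [[_ _ Df_bnd _] _] _] := A1.
have [M_x xM] := B2; have [M_xi xiM] := B5_bounded.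
have [delta [delta_ge0 delta0 dE]] := B4.
have theta_gt0 k : 0 < theta k by have [] := B3_pos k.
have theta0 : theta @ \oo --> (0 : R).
  by apply: cvg0_of_mul_ln B3_lim => k; exact: ltW.
have [rho [rho_ge0 rho_lt1 contr]] :=
  uniform_contraction sigma_gt0 eps_v_gt0 eps_v_lt B3_inf B3_sup.
have [c deltac] : exists c, forall k, delta k <= c.
  have /cvg_seq_bounded/pinfty_ex_gt0 [c _ /= dc] : cvgn delta by apply/cvg_ex; exists 0.
  by exists c => k; exact: le_trans (ler_norm _) (dc k I).
have [M_d dM] := @enlargement_bounded _ _ _ M_x c Df_bnd.
(* C bounds the coordinates of g_k + sigma x_k, and C0 those of s_0; the
   absolute values only make both nonnegative. *)
pose C := `|M_d| + `|M_xi| + sigma * `|M_x|.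
pose C0 := sigma * `|M_x| + `|M_x|.
have C_ge0 : 0 <= C by rewrite /C !addr_ge0 ?mulr_ge0 // ltW.
have C0_ge0 : 0 <= C0 by rewrite /C0 !addr_ge0 ?mulr_ge0 // ltW.
pose a k := rho * (1 + theta k); pose b k := rho * C * theta k.
have a_ge0 k : 0 <= a k by rewrite /a mulr_ge0 // addr_ge0 // ltW.
have b_ge0 k : 0 <= b k by rewrite /b !mulr_ge0 // ltW.
pose u := affine_recursion a b C0.
have u_ge0 k : 0 <= u k by exact: affine_recursion_ge0.
have u0 : u @ \oo --> (0 : R).
  apply: (@affine_recursion_cvg0 _ _ _ _ rho) => //.
    rewrite -[X in _ --> X]mulr1 -[X in _ * X]addr0.
    by apply: cvgMr; apply: cvgD => //; exact: cvg_cst.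
  by rewrite -[X in _ --> X](mulr0 (rho * C)); exact: cvgMr.
exists (fun k => Num.sqrt n%:R * u k); split.
- by move=> k; rewrite mulr_ge0 ?sqrtr_ge0.
- by rewrite -[X in _ --> X](mulr0 (Num.sqrt n%:R)); exact: cvgMr.
apply: filterS (filterI (filterI B1 xM) (filterI dE xiM)).
move=> w [[Hw [m0w xw]] [dw xiw]] k.
apply: enorm_le_coord => // i.
have xi_le j : `|x j w 0 i| <= `|M_x|.
  exact: le_trans (le_trans (coord_le_enorm _ _) (xw j)) (ler_norm _).
have sx_le j : `|sigma * x j w 0 i| <= sigma * `|M_x|.
  by rewrite normrM gtr0_norm // ler_wpM2l // ltW.
elim: k => [|k IH].
  rewrite !mxE; apply: le_trans (ler_normD _ _) _; apply: lerD => //.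
  exact: le_trans (le_trans (coord_le_enorm _ _) m0w) (ler_norm _).
have [gE mE xE] := xmv_afmdw w k.
have [Hlo Hhi] := Hw k.+1 i.
set s := (sigma *: x k w + m k w) 0 i in IH.
have sE : s = sigma * x k w 0 i + m k w 0 i by rewrite /s !mxE.
have stepE : (sigma *: x k.+1 w + m k.+1 w) 0 i =
    (1 - sigma * eta k * H (v k.+1 w) 0 i) *
    (s + theta k * (g k w 0 i + sigma * x k w 0 i - s)).
  by rewrite sE xE mE !mxE; ring.
have g_le : `|g k w 0 i| <= `|M_d| + `|M_xi|.
  rewrite gE mxE; apply: le_trans (ler_normD _ _) _; apply: lerD.
    by apply: le_trans (ler_norm _); apply: dM (deltac k) (dw k).
  exact: le_trans (le_trans (coord_le_enorm _ _) (xiw _)) (ler_norm _).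
have drift : `|g k w 0 i + sigma * x k w 0 i - s| <= C + u k.
  apply: le_trans (ler_normB _ _) _; apply: lerD IH.
  by apply: le_trans (ler_normD _ _) _; exact: lerD g_le (sx_le k).
rewrite stepE normrM.
apply: (@le_trans _ _ (rho * (u k + theta k * (C + u k)))).
  apply: ler_pM => //; first exact: contr.
  apply: le_trans (ler_normD _ _) _; apply: lerD IH _.
  by rewrite normrM gtr0_norm // ler_wpM2l // ltW.
rewrite /u /= -/u /a /b le_eqVlt; apply/orP; left; apply/eqP; ring.
Qed.
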